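(* Let $(E,\varphi,\phi_{E},\langle\!\langle\cdot,\cdot\rangle\!\rangle,\odot_{E},\rho_{E})$ be a Hom-Courant algebroid over $M$, $[\![\cdot,\cdot]\!]_{E}$ the Hom-Courant bracket on $\Gamma(E)$, and $L\subset E$ a subbundle which is a Hom-Dirac structure. Then $(L,\varphi,\phi_{E}|_{L},[\![\cdot,\cdot]\!]_E|_L,\rho_E|_L)$ is a Hom-Lie algebroid over $M$.
   Context: For a smooth map $\varphi:M\to M$, $\varphi^*f:=f\circ\varphi$; $\varphi^!TM$ is the pull-back bundle, whose sections $V$ act on functions by $(V(f))(p)=\langle(df)_{\varphi(p)},V_p\rangle$. For $\varphi$ a diffeomorphism and $X,Y\in\Gamma(\varphi^!TM)$: $\mathrm{Ad}_{\varphi^*}X:=\varphi^*\circ X\circ(\varphi^* )^{-1}$ and $[X,Y]_{\varphi^*}:=\varphi^*\circ X\circ(\varphi^* )^{-1}\circ Y\circ(\varphi^* )^{-1}-\varphi^*\circ Y\circ(\varphi^* )^{-1}\circ X\circ(\varphi^* )^{-1}$. A Hom-bundle $(A,\varphi,\phi_A)$ is a vector bundle $A\to M$, a smooth map $\varphi:M\to M$ and a linear map $\phi_A:\Gamma(A)\to\Gamma(A)$ with $\phi_A(fX)=\varphi^*f\cdot\phi_A(X)$; it is invertible if $\varphi$ is a diffeomorphism and $\phi_A$ is invertible. A Hom-Lie algebroid $(A,\varphi,\phi_A,[\cdot,\cdot]_A,a_A)$ over $M$ is an invertible Hom-bundle $(A,\varphi,\phi_A)$ (invertibility is a standing assumption)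 with a skew-symmetric $\mathbb R$-bilinear bracket $[\cdot,\cdot]_A$ on $\Gamma(A)$ satisfying $\phi_A[X,Y]_A=[\phi_A(X),\phi_A(Y)]_A$ and $[\phi_A(X),[Y,Z]_A]_A+[\phi_A(Y),[Z,X]_A]_A+[\phi_A(Z),[X,Y]_A]_A=0$, and a bundle map $a_A:A\to\varphi^!TM$ such that $[X,fY]_A=\varphi^*f[X,Y]_A+a_A(\phi_A(X))(f)\phi_A(Y)$, $a_A(\phi_A(X))\circ\varphi^*=\varphi^*\circ a_A(X)$ and $a_A([X,Y]_A)\circ\varphi^*=a_A(\phi_A(X))\circ a_A(Y)-a_A(\phi_A(Y))\circ a_A(X)$ (the last two are equivalent to $a_A\circ\phi_A=\mathrm{Ad}_{\varphi^*}\circ a_A$ and $a_A([X,Y]_A)=[a_A(X),a_A(Y)]_{\varphi^*}$). A Hom-Courant algebroid $(E,\varphi,\phi_E,\langle\!\langle\cdot,\cdot\rangle\!\rangle,\odot_E,\rho_E)$ over $M$ consists of an invertible Hom-bundle $(E,\varphi,\phi_E)$, a non-degenerate symmetric bilinear form $\langle\!\langle\cdot,\cdot\rangle\!\rangle$ on $E$, an ($\mathbb R$-)bilinear map $\odot_E:\Gamma(E)\times\Gamma(E)\to\Gamma(E)$ and a bundle map $\rho_E:E\to\varphi^!TM$ such that, for all $e,e_1,e_2,e_3\in\Gamma(E)$: (i) $\phi_E(e_1\odot_Ee_2)=\phi_E(e_1)\odot_E\phi_E(e_2)$ and $\phi_E(e_1)\odot_E(e_2\odot_Ee_3)=(e_1\odot_Ee_2)\odot_E\phi_E(e_3)+\phi_E(e_2)\odot_E(e_1\odot_Ee_3)$;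 (ii) $\rho_E\circ\phi_E=\mathrm{Ad}_{\varphi^*}\circ\rho_E$; (iii) $\rho_E(e_1\odot_Ee_2)=[\rho_E(e_1),\rho_E(e_2)]_{\varphi^*}$; (iv) $e\odot_Ee=\mathcal D\langle\!\langle e,e\rangle\!\rangle$; (v) $\langle\!\langle\phi_E(e_1),\phi_E(e_2)\rangle\!\rangle=\varphi^*\langle\!\langle e_1,e_2\rangle\!\rangle$; (vi) $\rho_E(\phi_E(e))(\langle\!\langle e_1,e_2\rangle\!\rangle)=\langle\!\langle e\odot_Ee_1,\phi_E(e_2)\rangle\!\rangle+\langle\!\langle\phi_E(e_1),e\odot_Ee_2\rangle\!\rangle$; where $\mathcal D:C^\infty(M)\to\Gamma(E)$ is defined by $\langle\!\langle\mathcal Df,e\rangle\!\rangle=\frac12\rho_E(e)f$. The Hom-Courant bracket is $[\![e_1,e_2]\!]_E:=\frac12(e_1\odot_Ee_2-e_2\odot_Ee_1)$. A subbundle $L\subset E$ is isotropic if it is isotropic for $\langle\!\langle\cdot,\cdot\rangle\!\rangle$, integrable if $\Gamma(L)$ is closed under $[\![\cdot,\cdot]\!]_E$, and $\phi_E$-invariant if $\phi_E(\Gamma(L))\subset\Gamma(L)$. $L$ is a Hom-Dirac structure if it is maximally isotropic, integrable and $\phi_E$-invariant. *)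

(* Defs.v *)
From HB Require Import structures.
From mathcomp Require Import all_boot all_order all_algebra.
From mathcomp Require Import all_classical all_reals.
From mathcomp Require Import topology normedtype landau derive.
Set Implicit Arguments.
Unset Strict Implicit.
Unset Printing Implicit Defensive.
Import Order.TTheory GRing.Theory Num.Theory.
Import numFieldNormedType.Exports.
Local Open Scope classical_set_scope.
Local Open Scope ring_scope.

Section Differentiability.
Context {R : realType}.
Implicit Types U V W : normedModType R.

(* C^k on an open set A: only the germs of f at the points of A matter. *)
Fixpoint Ck (k : nat) V W (A : set V) (f : V -> W) : Prop :=
  if k is k'.+1 then
    (forall x, A x -> differentiable f x) /\ (forall v, Ck k' A ('D_v f))
  else forall x, A x -> {for x, continuous f}.

Definition smooth_on V W (A : set V) (f : V -> W) := forall k, Ck k A f.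

Lemma Ck_diff k V W (A : set V) (f : V -> W) x :
  Ck k.+1 A f -> A x -> differentiable f x.
Proof. by move=> [h _] /h. Qed.

Lemma CkW k V W (A : set V) (f : V -> W) : Ck k.+1 A f -> Ck k A f.
Proof.
elim: k f => [|k IH] f [df Df]; first by move=> x /df /differentiable_continuous.
by split=> // v; exact/IH/Df.
Qed.

Lemma Ck_sub k V W (A B : set V) (f : V -> W) :
  A `<=` B -> Ck k B f -> Ck k A f.
Proof.
move=> AB; elim: k f => [|k IH] f; first by move=> h x /AB/h.
by move=> [h1 h2]; split=> [x /AB/h1 //|v]; exact/IH/h2.
Qed.

Lemma near_diff V W (f g : V -> W) x : (\near x, f x = g x) ->
  differentiable f x -> differentiable g x.
Proof.
move=> fg df; have fgx : f x = g x := nbhs_singleton fg.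
pose h := g \- f.
have -> : g = f + h by apply/funext => y; rewrite /h !fctE addrC subrK.
apply: differentiableD => //.
have h0 : \near x, h x = 0 by near=> y; rewrite /h /= (near fg y) ?subrr.
have [dh ch] : is_diff x h 0.
  pose z : {linear V -> W} := \0.
  have zc : continuous z by exact: cst_continuous.
  have e : h \o shift x = cst (h x) + z +o_ 0 id.
    apply/eqaddoP => e e0.
    have : \forall y \near (0 : V), h (y + x) = 0.
      by move: h0; rewrite [X in X -> _](near_shift 0) /= subr0 => h0; near=> y; near: y; exact: h0.
    apply: filterS => y hy.
    rewrite !fctE /= hy /h /= fgx subrr /z /= addr0 subr0 normr0.
    by apply: mulr_ge0; [exact: ltW|exact: normr_ge0].
  apply: DiffDef; first by apply/diff_locallyP; rewrite (diff_unique zc e).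
  by rewrite (diff_unique zc e).
exact: dh.
Unshelve. all: by end_near. Qed.

Lemma Ck_eq k V W (A : set V) (f g : V -> W) : open A ->
  (forall x, A x -> f x = g x) -> Ck k A f -> Ck k A g.
Proof.
move=> oA; elim: k f g => [|k IH] f g fg.
  move=> h x Ax; have := h x Ax; rewrite /prop_for /continuous_at (fg x Ax).
  apply: cvg_trans; apply: near_eq_cvg; near=> y; apply: fg; near: y.
  exact: open_nbhs_nbhs.
have nfg x : A x -> \near x, f x = g x.
  by move=> Ax; near=> y; apply: fg; near: y; exact: open_nbhs_nbhs.
move=> [df Df]; split=> [x Ax|v].
  exact: near_diff (nfg x Ax) (df x Ax).
apply: IH (Df v) => x Ax; apply: near_eq_derive.
by have := nfg x Ax.
Unshelve. all: by end_near. Qed.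

Lemma Ck_cover k V W (A : set V) (f : V -> W) :
  (forall x, A x -> exists B, [/\ open B, B x & Ck k B f]) -> Ck k A f.
Proof.
elim: k f => [|k IH] f h.
  by move=> x /h [B [_ Bx]]; apply.
split=> [x /h [B [_ Bx [df _]]]|v]; first exact: df.
by apply: IH => x /h [B [oB Bx [_ Bf]]]; exists B; split=> //; exact: Bf.
Qed.

Lemma Ck_cst k V W (A : set V) (w : W) : Ck k A (cst w).
Proof.
elim: k w => [|k IH] w /=; first by move=> x _; exact: cst_continuous.
split=> [x _|v]; first exact: differentiable_cst.
rewrite (_ : 'D_v _ = cst 0); first exact: IH.
by apply/funext => x; rewrite derive_cst.
Qed.

Lemma CkD k V W (A : set V) (f g : V -> W) : open A ->
  Ck k A f -> Ck k A g -> Ck k A (f \+ g).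
Proof.
move=> oA; elim: k f g => [|k IH] f g.
  by move=> hf hg x Ax; apply: continuousD; [exact: hf|exact: hg].
move=> [df Df] [dg Dg]; split=> [x Ax|v].
  by apply: differentiableD; [exact: df|exact: dg].
apply: (@Ck_eq _ _ _ _ ('D_v f \+ 'D_v g)) => //; last by apply: IH; [exact: Df|exact: Dg].
move=> x Ax; have := @deriveD _ _ _ f g x v (diff_derivable (df x Ax))
  (diff_derivable (dg x Ax)).
by move=> /esym.
Qed.

Lemma Ck_sum k V W (A : set V) (I : Type) (r : seq I) (P : pred I)
    (f : I -> V -> W) : open A ->
  (forall i, Ck k A (f i)) -> Ck k A (fun x => \sum_(i <- r | P i) f i x).
Proof.
move=> oA h; elim: r => [|i r IH].
  by apply: (Ck_eq oA (f := cst 0)) => [x _|]; [rewrite big_nil|exact: Ck_cst].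
case Pi: (P i).
  apply: (Ck_eq oA (f := f i \+ (fun x => \sum_(i <- r | P i) f i x))).
    by move=> x _; rewrite big_cons Pi.
  exact: CkD.
by apply: Ck_eq IH => // x _; rewrite big_cons Pi.
Qed.

Lemma is_diff_scale V W (f : V -> R) (g : V -> W) x :
  differentiable f x -> differentiable g x ->
  differentiable (fun y => f y *: g y) x /\
  forall v, 'D_v (fun y => f y *: g y) x = 'D_v f x *: g x + f x *: 'D_v g x.
Proof.
move=> df dg.
pose s := (@GRing.scale R W : R -> W -> W).
have sb : bilinear_for
  (GRing.Scale.Law.clone _ _ *:%R _) (GRing.Scale.Law.clone _ _ *:%R _) s.
  split=> [u'|u] a y z /=; first by rewrite /s scalerDl scalerA.
  by rewrite /s scalerDr !scalerA mulrC.
pose sM := bilinear_isBilinear.Build R R W W _ _ s sb.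
pose S : {bilinear R -> W -> W} := HB.pack s sM.
have Sc : continuous (fun p => S p.1 p.2).
  by move=> p; exact: scale_continuous.
have dp : differentiable (fun y => (f y, g y)) x by exact: differentiable_pair.
have dS := differentiable_bilin (f x, g x) Sc.
have dfg : differentiable (fun y => f y *: g y) x.
  exact: (differentiable_comp dp dS).
split=> // v; rewrite (deriveE v dfg).
have -> : 'd (fun y => f y *: g y) x v =
    ('d (fun p => S p.1 p.2) (f x, g x) \o 'd (fun y => (f y, g y)) x) v.
  by rewrite -diff_comp.
rewrite /comp; have -> := @diff_bilin _ _ _ _ S (f x, g x) Sc.
have -> := diff_pair df dg.
by rewrite !deriveE // addrC.
Qed.

Lemma CkZ k V W (A : set V) (f : V -> R) (g : V -> W) : open A ->
  Ck k A f -> Ck k A g -> Ck k A (fun x => f x *: g x).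
Proof.
move=> oA; elim: k f g => [|k IH] f g.
  move=> hf hg x Ax; apply: (@continuousZ R); [exact: hf|exact: hg].
move=> Hf Hg; have [df Df] := Hf; have [dg Dg] := Hg; split=> [x Ax|v].
  by have [] := is_diff_scale (df x Ax) (dg x Ax).
apply: (@Ck_eq _ _ _ _ ((fun x => 'D_v f x *: g x) \+ (fun x => f x *: 'D_v g x))) => //.
  by move=> x Ax /=; have [_ ->] := is_diff_scale (df x Ax) (dg x Ax).
by apply: CkD => //; apply: IH => //; [exact: Df|exact: CkW|exact: CkW|exact: Dg].
Qed.

Lemma Ck_lin k V W W' (A : set V) (l : {linear W -> W'}) (f : V -> W) :
  open A -> continuous l -> Ck k A f -> Ck k A (l \o f).
Proof.
move=> oA lc; elim: k f => [|k IH] f.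
  by move=> hf x Ax; apply: continuous_comp; [exact: hf|exact: lc].
move=> [df Df]; have dl y : differentiable l y by exact: linear_differentiable.
split=> [x Ax|v].
  by apply: differentiable_comp => //; exact: df.
apply: (@Ck_eq _ _ _ _ (l \o 'D_v f)) => //; last by apply: IH; exact: Df.
move=> x Ax; rewrite deriveE; last by apply: differentiable_comp => //; exact: df.
by rewrite diff_comp //=; [rewrite diff_lin// deriveE//; exact: df|exact: df].
Qed.

Definition coordl m n (i : 'I_m) (j : 'I_n) : 'M[R]_(m, n) -> R := fun N => N i j.
Lemma coordl_lin m n i j : linear (@coordl m n i j).
Proof. by move=> a u v; rewrite /coordl !mxE. Qed.
HB.instance Definition _ m n i j :=
  GRing.isLinear.Build R 'M[R]_(m, n) R _ (@coordl m n i j) (@coordl_lin m n i j).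

Lemma Ck_coord k V m n (A : set V) (f : V -> 'M[R]_(m, n)) i j :
  open A -> Ck k A f -> Ck k A (fun x => f x i j).
Proof.
by move=> oA h; apply: (@Ck_lin _ _ _ _ _ (@coordl m n i j)) => //; exact: coord_continuous.
Qed.

Lemma Ck_comp k V m W (A : set V) (B : set 'rV[R]_m) (g : V -> 'rV[R]_m)
    (f : 'rV[R]_m -> W) : open A -> (forall x, A x -> B (g x)) ->
  Ck k A g -> Ck k B f -> Ck k A (f \o g).
Proof.
move=> oA AB; elim: k f => [|k IH] f.
  move=> hg hf x Ax; apply: continuous_comp; [exact: hg|exact/hf/AB].
move=> Hg [df Df]; have [dg Dg] := Hg; split=> [x Ax|v].
  by apply: differentiable_comp; [exact: dg|exact/df/AB].
apply: (@Ck_eq _ _ _ _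
  (fun x => \sum_i ('D_v g x 0 i *: ('D_(delta_mx 0 i) f \o g) x))) => //.
  move=> x Ax; have dgx := dg x Ax; have dfx := df _ (AB x Ax).
  rewrite (deriveE v (differentiable_comp dgx dfx)) diff_comp //= -(deriveE v dgx).
  rewrite [in RHS](row_sum_delta ('D_v g x)) linear_sum.
  by apply: eq_bigr => i _; rewrite linearZ /= -(deriveE _ dfx).
apply: Ck_sum => // i; apply: CkZ => //.
  exact: (Ck_coord _ _ oA (Dg v)).
by apply: IH; [exact: CkW|exact: Df].
Qed.
End Differentiability.

Section SmoothOn.
Context {R : realType}.
Implicit Types V W : normedModType R.

Lemma smooth_sub V W (A B : set V) (f : V -> W) :
  A `<=` B -> smooth_on B f -> smooth_on A f.
Proof. by move=> AB h k; exact: Ck_sub (h k). Qed.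

Lemma smooth_eq V W (A : set V) (f g : V -> W) : open A ->
  (forall x, A x -> f x = g x) -> smooth_on A f -> smooth_on A g.
Proof. by move=> oA fg h k; exact: Ck_eq (h k). Qed.

Lemma smooth_cover V W (A : set V) (f : V -> W) :
  (forall x, A x -> exists B, [/\ open B, B x & smooth_on B f]) ->
  smooth_on A f.
Proof.
move=> h k; apply: Ck_cover => x /h [B [oB Bx Bf]]; exists B.
by split=> //; exact: Bf.
Qed.

Lemma smooth_derive V W (A : set V) (f : V -> W) v :
  smooth_on A f -> smooth_on A ('D_v f).
Proof. by move=> h k; have [_] := h k.+1; apply. Qed.

Lemma smooth_diff V W (A : set V) (f : V -> W) x :
  smooth_on A f -> A x -> differentiable f x.
Proof. by move=> h; exact: Ck_diff (h 1%N). Qed.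

Lemma smooth_comp V m W (A : set V) (B : set 'rV[R]_m) (g : V -> 'rV[R]_m)
    (f : 'rV[R]_m -> W) : open A -> (forall x, A x -> B (g x)) ->
  smooth_on A g -> smooth_on B f -> smooth_on A (f \o g).
Proof. by move=> oA AB hg hf k; exact: Ck_comp AB (hg k) (hf k). Qed.
End SmoothOn.

(* A chart is a homeomorphism from the open set cdom of T onto the open set cimg
   of R^n; cto and cinv are total functions, unconstrained off cdom and cimg. *)
Record chart (R : realType) (n : nat) (T : topologicalType) := Chart {
  cdom : set T;
  cimg : set 'rV[R]_n;
  cto :> T -> 'rV[R]_n;
  cinv : 'rV[R]_n -> T;
  cdom_open : open cdom;
  cimg_open : open cimg;
  cto_img : forall p, cdom p -> cimg (cto p);
  cinv_dom : forall x, cimg x -> cdom (cinv x);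
  ctoK : forall p, cdom p -> cinv (cto p) = p;
  cinvK : forall x, cimg x -> cto (cinv x) = x;
  cto_cont : forall p, cdom p -> {for p, continuous cto};
  cinv_cont : forall x, cimg x -> {for x, continuous cinv}
}.

(* The atlas need not be maximal. *)
Record manifold (R : realType) (n : nat) := Manifold {
  mpoint :> topologicalType;
  mhausdorff : hausdorff_space mpoint;
  msecond_countable : @second_countable mpoint;
  atlas : set (chart R n mpoint);
  atlas_cover : forall p : mpoint, exists2 c, atlas c & cdom c p;
  atlas_compat : forall c d : chart R n mpoint, atlas c -> atlas d ->
    smooth_on [set x | cimg c x /\ cdom d (cinv c x)] (d \o cinv c)
}.

Section SmoothMaps.
Context {R : realType} {n : nat}.
Implicit Types M : manifold R n.

(* smooth_fun U f: f is smooth on the open set U. *)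
Definition smooth_fun M (W : normedModType R) (U : set M) (f : M -> W) :=
  forall c : chart R n M, atlas c ->
    smooth_on [set x | cimg c x /\ U (cinv c x)] (f \o cinv c).

Definition smooth_map M (h : M -> M) := continuous h /\
  forall c d : chart R n M, atlas c -> atlas d ->
    smooth_on [set x | cimg c x /\ cdom d (h (cinv c x))] (d \o h \o cinv c).

Record smap M := SMap { smap_fun :> M -> M; smap_smooth : smooth_map smap_fun }.

Record Cinf M := MkCinf { Cinf_fun :> M -> R^o;
  Cinf_smooth : smooth_fun [set: M] Cinf_fun }.

Lemma cinv_open M (c : chart R n M) (U : set M) :
  open U -> open [set x | cimg c x /\ U (cinv c x)].
Proof.
rewrite !openE => oU x [cx Ux].
have := cinv_cont cx; move/(_ U (oU _ Ux)) => h.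
have := @cimg_open _ _ _ c; rewrite openE => /(_ x cx) h2.
by apply: filterI.
Qed.

Lemma cto_open M (c : chart R n M) (B : set 'rV[R]_n) :
  open B -> open [set p | cdom c p /\ B (c p)].
Proof.
rewrite !openE => oB p [cp Bp].
have h := cto_cont cp (oB _ Bp).
have := @cdom_open _ _ _ c; rewrite openE => /(_ p cp) h2.
by apply: filterI.
Qed.

Lemma preimage_open M (h : smap M) (U : set M) : open U -> open (h @^-1` U).
Proof. by case: h => h [ch hs] /= oU; apply: open_comp => // x _; exact: ch. Qed.

Section fs.
Variables (M : manifold R n) (W : normedModType R).
Implicit Types (U : set M) (f g : M -> W).

Lemma fs_sub U U' f : U `<=` U' -> smooth_fun U' f -> smooth_fun U f.
Proof. by move=> UU h c ca; apply: smooth_sub (h c ca) => x [cx /UU]. Qed.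

Lemma fs_eq U f g : open U -> (forall p, U p -> f p = g p) ->
  smooth_fun U f -> smooth_fun U g.
Proof.
move=> oU fg h c ca; apply: smooth_eq (h c ca); first exact: cinv_open.
by move=> x [cx Ux] /=; exact: fg.
Qed.

Lemma fs_cover U f : (forall p, U p ->
  exists U', [/\ open U', U' p & smooth_fun U' f]) -> smooth_fun U f.
Proof.
move=> h c ca; apply: smooth_cover => x [cx Ux].
have [U' [oU' U'x h']] := h _ Ux.
exists [set x | cimg c x /\ U' (cinv c x)].
by split; [exact: cinv_open|split|exact: h'].
Qed.

Lemma fsD U f g : open U -> smooth_fun U f -> smooth_fun U g ->
  smooth_fun U (f \+ g).
Proof.
move=> oU hf hg c ca k; apply: (@CkD _ k _ _ _ (f \o cinv c) (g \o cinv c)).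
- exact: cinv_open.
- exact: hf.
- exact: hg.
Qed.

Lemma fs_sum U (I : Type) (r : seq I) (P : pred I) (f : I -> M -> W) : open U ->
  (forall i, smooth_fun U (f i)) ->
  smooth_fun U (fun x => \sum_(i <- r | P i) f i x).
Proof.
move=> oU h c ca k; apply: (@Ck_sum _ k _ _ _ _ r P (fun i => f i \o cinv c)).
  exact: cinv_open.
by move=> i; exact: h.
Qed.

Lemma fsZ U (f : M -> R^o) g : open U -> smooth_fun U f ->
  smooth_fun U g -> smooth_fun U (fun p => f p *: g p).
Proof.
move=> oU hf hg c ca k.
apply: (@CkZ _ k _ _ _ (f \o cinv c) (g \o cinv c)).
- exact: cinv_open.
- exact: hf.
- exact: hg.
Qed.

Lemma fs_cst U (w : W) : smooth_fun U (fun=> w).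
Proof. by move=> c ca k; exact: Ck_cst. Qed.

Lemma fs_lin (W' : normedModType R) (l : {linear W -> W'}) U f : open U ->
  continuous l -> smooth_fun U f -> smooth_fun U (l \o f).
Proof.
move=> oU lc hf c ca k; apply: (@Ck_lin _ k _ _ _ _ l (f \o cinv c)) => //.
  exact: cinv_open.
exact: hf.
Qed.

Lemma fs_pull (h : smap M) U f : open U -> smooth_fun U f ->
  smooth_fun (h @^-1` U) (f \o h).
Proof.
move=> oU hf c ca; have [ch hs] := smap_smooth h.
apply: smooth_cover => x [cx Ux].
have [d da dx] := atlas_cover (h (cinv c x)).
exists [set y | cimg c y /\ (h @^-1` (U `&` cdom d)) (cinv c y)].
have oB : open [set y | cimg c y /\ (h @^-1` (U `&` cdom d)) (cinv c y)].
  apply/cinv_open/preimage_open/openI => //. exact: cdom_open.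
split=> //.
apply: (@smooth_eq _ _ _ _ ((f \o cinv d) \o (d \o h \o cinv c))) => //.
  by move=> y [cy [Uy dy]] /=; rewrite ctoK.
apply: (smooth_comp (B := [set z | cimg d z /\ U (cinv d z)])) => //.
- by move=> y [cy [Uy dy]] /=; rewrite ctoK //; split=> //; exact: cto_img.
- by apply: smooth_sub (hs c d ca da) => y [cy [_ dy]].
- exact: hf.
Qed.

Lemma fs_cto (c : chart R n M) (B : set 'rV[R]_n) (g : 'rV[R]_n -> W) :
  atlas c -> open B -> smooth_on B g ->
  smooth_fun [set p | cdom c p /\ B (c p)] (g \o c).
Proof.
move=> ca oB hg d da.
apply: (smooth_comp (B := B) (g := c \o cinv d)) => //.
- exact/cinv_open/cto_open.
- by move=> x [_ []].
- by apply: smooth_sub (atlas_compat da ca) => x [dx []].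
Qed.
End fs.

Lemma pull_smooth M (h : smap M) (f : Cinf M) :
  smooth_fun [set: M] (f \o h : M -> R^o).
Proof.
rewrite -(preimage_setT h); apply: fs_pull; first exact: openT.
exact: Cinf_smooth.
Qed.
(* phi^* f = f \o phi *)
Definition pull M (h : smap M) (f : Cinf M) : Cinf M := MkCinf (pull_smooth h f).

End SmoothMaps.

Record diffeo (R : realType) (n : nat) (M : manifold R n) := Diffeo {
  diffeo_map :> smap M;
  diffeo_inv : smap M;
  diffeoK : cancel diffeo_map diffeo_inv;
  diffeo_invK : cancel diffeo_inv diffeo_map
}.

Section Triv.
Context {R : realType} {n : nat} {M : manifold R n}.

(* A local trivialization over tdom of the family of vector spaces F, given
   fibrewise; off tdom the linear maps tmap p and tinv p are unconstrained. *)
Record triv (r : nat) (F : M -> vectType R) := Triv {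
  tdom : set M;
  tmap : forall p, {linear F p -> 'rV[R]_r};
  tinv : forall p, {linear 'rV[R]_r -> F p};
  tdom_open : open tdom;
  tmapK : forall p, tdom p -> cancel (tmap p) (tinv p);
  tinvK : forall p, tdom p -> cancel (tinv p) (tmap p)
}.

Definition smooth_trans r F (t u : triv r F) := forall w : 'rV[R]_r,
  smooth_fun (tdom t `&` tdom u) (fun p => tmap u p (tinv t p w)).

Lemma fs_app (W : normedModType R) r (U : set M)
    (l : forall p : M, {linear 'rV[R]_r -> W}) (s : M -> 'rV[R]_r) : open U ->
  (forall w, smooth_fun U (fun p => l p w)) -> smooth_fun U s ->
  smooth_fun U (fun p => l p (s p)).
Proof.
move=> oU hl hs.
apply: (@fs_eq _ _ _ _ _ (fun p => \sum_i (s p 0 i *: l p (delta_mx 0 i)))) => //.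
  move=> p _; rewrite [in RHS](row_sum_delta (s p)) linear_sum.
  by apply: eq_bigr => i _; rewrite linearZ.
apply: fs_sum => // i; apply: fsZ => // c ca k.
apply: (@Ck_coord _ k _ _ _ _ (s \o cinv c)); first exact: cinv_open.
exact: hs.
Qed.
End Triv.

(* A smooth vector bundle of rank vrank, given by its fibres and an atlas of local
   trivializations with smooth transition functions; these determine the topology
   and the smooth structure of the total space. *)
Record vbundle (R : realType) (n : nat) (M : manifold R n) := VBundle {
  vrank : nat;
  vfib :> M -> vectType R;
  vtrivs : set (triv vrank vfib);
  vtrivs_cover : forall p, exists2 t, vtrivs t & tdom t p;
  vtrivs_compat : forall t u : triv vrank vfib, vtrivs t -> vtrivs u ->
    smooth_trans t u
}.

Section Sections.
Context {R : realType} {n : nat} {M : manifold R n}.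
Implicit Types A B : vbundle M.

(* t belongs to the maximal atlas of local trivializations of A. *)
Definition smooth_triv A (t : triv (vrank A) A) :=
  forall u, vtrivs u -> smooth_trans t u /\ smooth_trans u t.

Definition smooth_sect A (s : forall p, A p) := forall t, vtrivs t ->
  smooth_fun (tdom t) (fun p => tmap t p (s p)).

Lemma trans_sect A (t u : triv (vrank A) A) (s : forall p, A p) (U : set M) :
  open U -> smooth_trans t u -> smooth_fun (U `&` tdom t) (fun p => tmap t p (s p)) ->
  smooth_fun (U `&` tdom t `&` tdom u) (fun p => tmap u p (s p)).
Proof.
move=> oU tu h.
have oI : open (U `&` tdom t `&` tdom u).
  by do 2?apply: openI => //; exact: tdom_open.
apply: (@fs_eq _ _ _ _ _ (fun p => (tmap u p \o tinv t p) (tmap t p (s p)))) => //.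
  by move=> p [[_ tp] up] /=; rewrite tmapK.
apply: (fs_app (l := fun p => tmap u p \o tinv t p)) => //.
  by move=> w; apply: fs_sub (tu w) => p [[_ ?] ?].
by apply: fs_sub h => p [].
Qed.

Lemma smooth_sect_cover A (s : forall p, A p) :
  (forall p, exists t U, [/\ open U, U p, tdom t p, smooth_triv t &
     smooth_fun (U `&` tdom t) (fun p => tmap t p (s p))]) -> smooth_sect s.
Proof.
move=> h u ua; apply: fs_cover => p up; have [t [U [oU Up tp ts h']]] := h p.
exists (U `&` tdom t `&` tdom u); split=> //.
  by do 2?apply: openI => //; exact: tdom_open.
by apply: trans_sect h' => //; have [] := ts u ua.
Qed.

Lemma vtrivs_smooth A (t : triv (vrank A) A) : vtrivs t -> smooth_triv t.
Proof. by move=> ta u ua; split; exact: vtrivs_compat. Qed.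

Lemma smooth_sect_triv A (s : forall p, A p) t : smooth_sect s -> smooth_triv t ->
  smooth_fun (tdom t) (fun p => tmap t p (s p)).
Proof.
move=> hs ht; apply: fs_cover => p tp; have [u ua up] := vtrivs_cover A p.
exists (setT `&` tdom u `&` tdom t); split=> //.
  by do 2?apply: openI; [exact: openT|exact: tdom_open|exact: tdom_open].
apply: trans_sect; first exact: openT.
  by have [] := ht u ua.
by apply: fs_sub (hs u ua) => q [].
Qed.

Record sect A := MkSect { sect_fun :> forall p, A p;
  sect_smooth : smooth_sect sect_fun }.

Lemma sectP A (s t : sect A) : (forall p, s p = t p) -> s = t.
Proof.
case: s t => s hs [t ht] /= st.
have e : s = t by apply: functional_extensionality_dep.
by case: _ / e ht => ht; congr MkSect; exact: Prop_irrelevance.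
Qed.

HB.instance Definition _ A := gen_eqMixin (sect A).
HB.instance Definition _ A := gen_choiceMixin (sect A).

Lemma sect0_subproof A : smooth_sect (fun p => 0 : A p).
Proof.
move=> t ta; apply: (fs_eq (f := fun=> 0)); first exact: tdom_open.
  by move=> p _; rewrite linear0.
exact: fs_cst.
Qed.

Lemma sectD_subproof A (s t : sect A) : smooth_sect (fun p => s p + t p).
Proof.
move=> u ua; apply: (fs_eq (f := (fun p => tmap u p (s p)) \+ (fun p => tmap u p (t p)))).
- exact: tdom_open.
- by move=> p _; rewrite linearD.
- by apply: fsD; [exact: tdom_open|exact: sect_smooth|exact: sect_smooth].
Qed.

Lemma sectZ_subproof A (f : Cinf M) (s : sect A) : smooth_sect (fun p => (f p : R) *: s p).
Proof.
move=> u ua; apply: (fs_eq (f := fun p => f p *: tmap u p (s p))).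
- exact: tdom_open.
- by move=> p _; rewrite linearZ.
- apply: fsZ; [exact: tdom_open| |exact: sect_smooth].
  by apply: fs_sub (@Cinf_smooth _ _ _ f).
Qed.

Definition sect_smul A (f : Cinf M) (s : sect A) : sect A := MkSect (sectZ_subproof f s).

Definition Cinf_cst (a : R) : Cinf M := @MkCinf _ _ M (fun=> a) (@fs_cst _ _ M R^o _ a).

Definition sect0 A : sect A := MkSect (@sect0_subproof A).
Definition sectD A (s t : sect A) : sect A := MkSect (sectD_subproof s t).
Definition sectZ A (a : R) (s : sect A) : sect A := sect_smul (Cinf_cst a) s.
Definition sectN A (s : sect A) : sect A := sectZ (-1) s.

Lemma sectDA A : associative (@sectD A).
Proof. by move=> s t u; apply: sectP => p; rewrite /= addrA. Qed.
Lemma sectDC A : commutative (@sectD A).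
Proof. by move=> s t; apply: sectP => p; rewrite /= addrC. Qed.
Lemma sect0D A : left_id (@sect0 A) (@sectD A).
Proof. by move=> s; apply: sectP => p; rewrite /= add0r. Qed.
Lemma sectND A : left_inverse (@sect0 A) (@sectN A) (@sectD A).
Proof. by move=> s; apply: sectP => p; rewrite /= scaleN1r addNr. Qed.
HB.instance Definition _ A := GRing.isZmodule.Build (sect A)
  (@sectDA A) (@sectDC A) (@sect0D A) (@sectND A).

Lemma sectZA A a b (s : sect A) : sectZ a (sectZ b s) = sectZ (a * b) s.
Proof. by apply: sectP => p; rewrite /= scalerA. Qed.
Lemma sect1Z A : left_id 1 (@sectZ A).
Proof. by move=> s; apply: sectP => p; rewrite /= scale1r. Qed.
Lemma sectZDr A : right_distributive (@sectZ A) +%R.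
Proof. by move=> a s t; apply: sectP => p; rewrite /= scalerDr. Qed.
Lemma sectZDl A (s : sect A) : {morph (@sectZ A)^~ s : a b / a + b}.
Proof. by move=> a b; apply: sectP => p; rewrite /= scalerDl. Qed.
HB.instance Definition _ A := GRing.Zmodule_isLmodule.Build R (sect A)
  (@sectZA A) (@sect1Z A) (@sectZDr A) (@sectZDl A).

(* Smooth bundle maps over the identity of M: fibrewise linear, with smooth
   coordinates in local trivializations. *)
Record bmap A B := BMap {
  bmap_fun :> forall p, {linear A p -> B p};
  bmap_smooth : forall t u, vtrivs t -> vtrivs u -> forall w,
    smooth_fun (tdom t `&` tdom u) (fun p => tmap u p (bmap_fun p (tinv t p w)))
}.

Lemma bapp_subproof A B (a : bmap A B) (s : sect A) : smooth_sect (fun p => a p (s p)).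
Proof.
move=> u ua; apply: fs_cover => p up; have [t ta tp] := vtrivs_cover A p.
have oI : open (tdom t `&` tdom u) by apply: openI; exact: tdom_open.
exists (tdom t `&` tdom u); split=> //.
apply: (@fs_eq _ _ _ _ _ (fun p => (tmap u p \o a p \o tinv t p) (tmap t p (s p)))) => //.
  by move=> q [tq uq] /=; rewrite tmapK.
apply: (fs_app (l := fun p => tmap u p \o a p \o tinv t p)) => //.
  by move=> w; exact: bmap_smooth.
by apply: fs_sub (sect_smooth s ta) => q [].
Qed.
Definition bapp A B (a : bmap A B) (s : sect A) : sect B := MkSect (bapp_subproof a s).

(* Smooth fibrewise bilinear forms. *)
Record bform A := BForm {
  bform_fun :> forall p, A p -> A p -> R;
  bform_linl : forall p (v : A p), scalar ((@bform_fun p)^~ v);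
  bform_linr : forall p (v : A p), scalar (@bform_fun p v);
  bform_smooth : forall t, vtrivs t -> forall w z,
    smooth_fun (tdom t) (fun p => @bform_fun p (tinv t p w) (tinv t p z) : R^o)
}.

Definition bform_linl_lin A (b : bform A) p (v : A p) : {linear A p -> R^o} :=
  HB.pack (fun u => b p u v : R^o) (GRing.isLinear.Build R (A p) R^o *:%R _ (bform_linl b v)).
Definition bform_linr_lin A (b : bform A) p (v : A p) : {linear A p -> R^o} :=
  HB.pack (fun u => b p v u : R^o) (GRing.isLinear.Build R (A p) R^o *:%R _ (bform_linr b v)).

Lemma pairing_subproof A (b : bform A) (s z : sect A) :
  smooth_fun [set: M] (fun p => b p (s p) (z p) : R^o).
Proof.
apply: fs_cover => p _; have [t ta tp] := vtrivs_cover A p.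
have oI := @tdom_open _ _ _ _ _ t.
exists (tdom t); split=> //.
apply: (@fs_eq _ _ _ _ _ (fun p => (bform_linl_lin b (z p) \o tinv t p) (tmap t p (s p)))) => //.
  by move=> q tq /=; rewrite tmapK.
apply: (fs_app (l := fun p => bform_linl_lin b (z p) \o tinv t p)) => //; last first.
  exact: sect_smooth.
move=> w.
apply: (@fs_eq _ _ _ _ _ (fun p => (bform_linr_lin b (tinv t p w) \o tinv t p) (tmap t p (z p)))) => //.
  by move=> q tq /=; rewrite tmapK.
apply: (fs_app (l := fun p => bform_linr_lin b (tinv t p w) \o tinv t p)) => //; last first.
  exact: sect_smooth.
by move=> w'; exact: bform_smooth.
Qed.
Definition pairing A (b : bform A) (s z : sect A) : Cinf M := MkCinf (pairing_subproof b s z).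
End Sections.

Section Tangent.
Context {R : realType} {n : nat} (M : manifold R n).

(* An arbitrary choice of a chart of the atlas around p. *)
Definition chart_at (p : M) : chart R n M := s2val (cid2 (atlas_cover p)).

Lemma chart_at_atlas p : atlas (chart_at p).
Proof. exact: s2valP (cid2 (atlas_cover p)). Qed.

Lemma chart_at_dom p : cdom (chart_at p) p.
Proof. exact: s2valP' (cid2 (atlas_cover p)). Qed.

Lemma diff_chain (U V W : normedModType R) (f : U -> V) (g : V -> W) x y v :
  differentiable f x -> differentiable g y -> f x = y ->
  'd g y ('d f x v) = 'd (g \o f) x v.
Proof. by move=> df dg e; move: dg; rewrite -e => dg; rewrite (diff_comp df dg). Qed.

Lemma diff_near (V W : normedModType R) (f g : V -> W) x v :
  differentiable f x -> (\near x, f x = g x) -> 'd f x v = 'd g x v.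
Proof.
move=> df fg; rewrite -!deriveE //; first exact: near_eq_derive.
exact: near_diff fg df.
Qed.

Lemma diff_id_near (V : normedModType R) (f : V -> V) x v :
  (\near x, x = f x) -> 'd f x v = v.
Proof.
have did := @is_diff_id R V x.
by move=> h; rewrite -(diff_near v ex_diff h) diff_val.
Qed.

Lemma diff_chart (W : normedModType R) (U : set M) (f : M -> W) (c d : chart R n M)
    q v : open U -> U q -> smooth_fun U f -> atlas c -> atlas d -> cdom c q ->
  cdom d q ->
  'd (f \o cinv d) (d q) ('d (d \o cinv c) (c q) v) = 'd (f \o cinv c) (c q) v.
Proof.
move=> oU Uq hf ca da cq dq.
have df : differentiable (f \o cinv d) (d q).
  by apply: (smooth_diff (hf d da)); rewrite /= ctoK //; split=> //; exact: cto_img.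
have df' : differentiable (f \o cinv c) (c q).
  by apply: (smooth_diff (hf c ca)); rewrite /= ctoK //; split=> //; exact: cto_img.
have dd : differentiable (d \o cinv c) (c q).
  by apply: (smooth_diff (atlas_compat ca da)); rewrite /= ctoK //; split=> //;
     exact: cto_img.
have e0 : (d \o cinv c) (c q) = d q by rewrite /= ctoK.
apply: (etrans (diff_chain v dd df e0)); apply/esym; apply: (diff_near v df').
have oB : open [set x | cimg c x /\ cdom d (cinv c x)].
  by apply: cinv_open; exact: cdom_open.
have : nbhs (c q) [set x | cimg c x /\ cdom d (cinv c x)].
  by apply: open_nbhs_nbhs; split=> //=; rewrite ctoK //; split=> //; exact: cto_img.
apply: filterS => x [cx dx].
by rewrite /comp (ctoK dx).
Qed.

Lemma diff_chartK (c : chart R n M) q v : atlas c -> cdom c q ->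
  'd (c \o cinv c) (c q) v = v.
Proof.
move=> ca cq; apply: diff_id_near.
have : nbhs (c q) (cimg c).
  by apply: open_nbhs_nbhs; split; [exact: cimg_open|exact: cto_img].
by apply: filterS => x cx; rewrite /comp cinvK.
Qed.

(* A tangent vector at p is represented by its components in the chart chart_at p.
   tan_map c p and tan_inv c p change these components to and from the components
   in c by the differential of the change of charts; the local trivializations
   tan_map make the choice of chart_at irrelevant for smoothness. *)
Definition tangent_fiber (p : M) : vectType R := 'rV[R]_n.

Definition tan_map (c : chart R n M) (p : M) : {linear tangent_fiber p -> 'rV[R]_n} :=
  'd (c \o cinv (chart_at p)) (chart_at p p).

Definition tan_inv (c : chart R n M) (p : M) : {linear 'rV[R]_n -> tangent_fiber p} :=
  'd (chart_at p \o cinv c) (c p).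

Lemma tan_mapK c p : atlas c -> cdom c p -> cancel (tan_map c p) (tan_inv c p).
Proof.
move=> ca cp v; have ka := chart_at_atlas p; have kp := chart_at_dom p.
have ks : smooth_fun (cdom (chart_at p)) (chart_at p).
  by move=> d da; exact: atlas_compat.
have oK := @cdom_open _ _ _ (chart_at p).
apply: (etrans (diff_chart v oK kp ks ka ca kp cp)).
exact: diff_chartK.
Qed.

Lemma tan_mapinv c d p v : atlas c -> atlas d -> cdom c p -> cdom d p ->
  tan_map d p (tan_inv c p v) = 'd (d \o cinv c) (c p) v.
Proof.
move=> ca da cp dp; have ka := chart_at_atlas p; have kp := chart_at_dom p.
have ds : smooth_fun (cdom d) d by move=> e ea; exact: atlas_compat.
exact: (diff_chart v (@cdom_open _ _ _ d) dp ds ca ka cp kp).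
Qed.

Lemma tan_invK c p : atlas c -> cdom c p -> cancel (tan_inv c p) (tan_map c p).
Proof.
move=> ca cp v; apply: (etrans (tan_mapinv v ca ca cp cp)).
exact: diff_chartK.
Qed.

Definition tan_triv c (ca : atlas c) : triv n tangent_fiber :=
  @Triv R n M n tangent_fiber (cdom c) (tan_map c) (tan_inv c) (@cdom_open _ _ _ c)
    (fun p => @tan_mapK c p ca) (fun p => @tan_invK c p ca).

Definition tan_trivs : set (triv n tangent_fiber) :=
  [set t | exists c (ca : atlas c), t = tan_triv ca].

Lemma tan_cover p : exists2 t, tan_trivs t & tdom t p.
Proof.
have [c ca cp] := atlas_cover p; exists (tan_triv ca) => //.
by exists c, ca.
Qed.

Lemma tan_compat t u : tan_trivs t -> tan_trivs u -> smooth_trans t u.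
Proof.
move=> [c [ca ->]] [d [da ->]] w /=.
have oI : open (cdom c `&` cdom d) by apply: openI; exact: cdom_open.
apply: (@fs_eq _ _ _ _ _ ('D_w (d \o cinv c) \o c)) => //.
  move=> p [cp dp]; apply: esym; apply: (etrans (tan_mapinv w ca da cp dp)).
  apply/esym; apply: deriveE.
  by apply: (smooth_diff (atlas_compat ca da)); rewrite /= ctoK //; split=> //; exact: cto_img.
have := fs_cto ca _ (smooth_derive w (atlas_compat ca da)).
move/(_ (cinv_open (@cdom_open _ _ _ d))); apply: fs_sub => p [cp dp] /=.
by rewrite ctoK //; split=> //; split=> //; exact: cto_img.
Qed.

Definition tangent_bundle : vbundle M := VBundle tan_cover tan_compat.

Section Pullback.
Variables (h : smap M) (B : vbundle M).

Definition pull_triv (t : triv (vrank B) B) : triv (vrank B) (fun p => B (h p)) :=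
  @Triv R n M (vrank B) (fun p => B (h p)) (h @^-1` tdom t)
    (fun p => tmap t (h p)) (fun p => tinv t (h p))
    (preimage_open h (@tdom_open _ _ _ _ _ t))
    (fun p => @tmapK _ _ _ _ _ t (h p)) (fun p => @tinvK _ _ _ _ _ t (h p)).

Definition pull_trivs : set (triv (vrank B) (fun p => B (h p))) :=
  pull_triv @` @vtrivs _ _ _ B.

Lemma pull_cover p : exists2 t, pull_trivs t & tdom t p.
Proof.
have [t ta tp] := vtrivs_cover B (h p); exists (pull_triv t) => //.
by exists t.
Qed.

Lemma pull_compat t u : pull_trivs t -> pull_trivs u -> smooth_trans t u.
Proof.
move=> [t' ta <-] [u' ua <-] w.
have oI : open (tdom t' `&` tdom u') by apply: openI; exact: tdom_open.
exact: (@fs_pull _ _ _ _ h _ _ oI (vtrivs_compat ta ua w)).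
Qed.

Definition pull_bundle : vbundle M := VBundle pull_cover pull_compat.
End Pullback.

(* <(df)_q, v> *)
Definition dfun (f : M -> R^o) (q : M) (v : tangent_bundle q) : R :=
  'd (f \o cinv (chart_at q)) (chart_at q q) v.
Arguments dfun f q v : clear implicits.

Lemma act_subproof (h : smap M) (V : sect (pull_bundle h tangent_bundle)) (f : Cinf M) :
  smooth_fun [set: M] (fun p => dfun f (h p) (V p) : R^o).
Proof.
apply: fs_cover => p _; have [d da dp] := atlas_cover (h p).
have oU : open (h @^-1` cdom d) by apply: preimage_open; exact: cdom_open.
exists (h @^-1` cdom d); split=> //.
apply: (@fs_eq _ _ _ _ _ (fun p => 'd (f \o cinv d) (d (h p)) (tan_map d (h p) (V p)))) => //.
  move=> q dq; have ka := chart_at_atlas (h q); have kq := chart_at_dom (h q).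
  exact: (diff_chart (V q) openT I (@Cinf_smooth _ _ _ f) ka da kq dq).
apply: (fs_app (l := fun p => 'd (f \o cinv d) (d (h p)))) => //; last first.
  have tV : @vtrivs _ _ _ (pull_bundle h tangent_bundle) (@pull_triv h tangent_bundle (tan_triv da)).
    by exists (tan_triv da) => //; exists d, da.
  exact: (@sect_smooth _ _ _ (pull_bundle h tangent_bundle) V _ tV).
move=> w.
have fd : smooth_on (cimg d) (f \o cinv d).
  by apply: smooth_sub (Cinf_smooth f da) => x dx; split.
apply: (@fs_eq _ _ _ _ _ (('D_w (f \o cinv d) \o d) \o h)) => //.
  by move=> q dq; apply: deriveE; apply: smooth_diff fd _; exact: cto_img.
apply: fs_pull; first exact: cdom_open.
have := fs_cto da (@cimg_open _ _ _ d) (smooth_derive w fd).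
by apply: fs_sub => q dq; split=> //; exact: cto_img.
Qed.
(* V(f) : p |-> <(df)_(h p), V_p>, for V a section of h^!TM *)
Definition act (h : smap M) (V : sect (pull_bundle h tangent_bundle)) (f : Cinf M) : Cinf M :=
  MkCinf (act_subproof V f).
End Tangent.

Section Subbundle.
Context {R : realType} {n : nat} {M : manifold R n}.
Variable E : vbundle M.

(* t maps L_p onto R^k x 0 for all p in its domain. *)
Definition adapted_triv (k : nat) (L : forall p, {vspace E p}) (t : triv (vrank E) E) :=
  smooth_triv t /\ forall p, tdom t p -> forall v : E p,
    v \in L p <-> forall i : 'I_(vrank E), (k <= i)%N -> tmap t p v 0 i = 0.

Record subbundle := Subbundle {
  srank : nat;
  sfib :> forall p, {vspace E p};
  srank_le : (srank <= vrank E)%N;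
  sub_adapted : forall p, exists2 t, adapted_triv srank sfib t & tdom t p
}.

Section Sub.
Variable L : subbundle.
Let k := srank L.

Definition sub_fiber (p : M) : vectType R := subvs_of (L p).

Definition sub_map (t : triv (vrank E) E) p : {linear sub_fiber p -> 'rV[R]_k} :=
  mulmxr (pid_mx k : 'M_(vrank E, k)) \o tmap t p \o vsval.

Definition sub_inv (t : triv (vrank E) E) p : {linear 'rV[R]_k -> sub_fiber p} :=
  vsproj (L p) \o tinv t p \o mulmxr (pid_mx k : 'M_(k, vrank E)).

Lemma pid_low (w : 'rV[R]_k) (i : 'I_(vrank E)) : (k <= i)%N ->
  (w *m (pid_mx k : 'M_(k, vrank E))) 0 i = 0.
Proof.
move=> ki; rewrite mxE big1 // => j _; rewrite mxE.
by rewrite (_ : (j == i :> nat) = false) ?mulr0 //; apply/eqP => ji; move: (ltn_ord j); rewrite ji ltnNge ki.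
Qed.

Lemma sub_inv_in t p (w : 'rV[R]_k) : adapted_triv k L t -> tdom t p ->
  tinv t p (w *m (pid_mx k : 'M_(k, vrank E))) \in L p.
Proof.
by move=> [_ ta] tp; apply/(ta p tp) => i ki; rewrite tinvK // pid_low.
Qed.

Lemma pid_pid (v : 'rV[R]_(vrank E)) :
  (forall i : 'I_(vrank E), (k <= i)%N -> v 0 i = 0) ->
  v *m (pid_mx k : 'M_(vrank E, k)) *m (pid_mx k : 'M_(k, vrank E)) = v.
Proof.
move=> hv; rewrite -mulmxA pid_mx_id //.
apply/rowP => i; rewrite mxE (bigD1 i) //= big1 ?addr0.
  rewrite mxE eqxx /=; case: ltnP => [|ki]; first by rewrite mulr1.
  by rewrite hv // mul0r.
by move=> j ji; rewrite mxE (negbTE (_ : j != i :> nat)) ?mulr0.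
Qed.

Lemma sub_mapK t p : adapted_triv k L t -> tdom t p ->
  cancel (sub_map t p) (sub_inv t p).
Proof.
move=> ta tp v; apply: val_inj; rewrite /= pid_pid; last first.
  by apply/(ta.2 p tp); exact: subvsP.
by rewrite tmapK // vsvalK.
Qed.

Lemma sub_invK t p : adapted_triv k L t -> tdom t p ->
  cancel (sub_inv t p) (sub_map t p).
Proof.
move=> ta tp w; rewrite /= vsprojK ?sub_inv_in // tinvK // -mulmxA.
by rewrite pid_mx_id ?srank_le // pid_mx_1 mulmx1.
Qed.

Definition sub_triv t (ta : adapted_triv k L t) : triv k sub_fiber :=
  @Triv R n M k sub_fiber (tdom t) (sub_map t) (sub_inv t) (@tdom_open _ _ _ _ _ t)
    (fun p => @sub_mapK t p ta) (fun p => @sub_invK t p ta).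

Definition sub_trivs : set (triv k sub_fiber) :=
  [set t | exists u (ua : adapted_triv k L u), t = sub_triv ua].

Lemma sub_cover p : exists2 t, sub_trivs t & tdom t p.
Proof.
by have [t ta tp] := sub_adapted L p; exists (sub_triv ta) => //; exists t, ta.
Qed.

Lemma smooth_trans2 (t u : triv (vrank E) E) :
  smooth_triv t -> smooth_triv u -> smooth_trans t u.
Proof.
move=> ts us w.
apply: fs_cover => p [tp up]; have [v va vp] := vtrivs_cover E p.
have oI : open (tdom t `&` tdom v) by apply: openI; exact: tdom_open.
exists (tdom t `&` tdom v `&` tdom v `&` tdom u); split=> //.
  by do 2?apply: openI => //; exact: tdom_open.
apply: (@trans_sect _ _ _ E v u (fun p => tinv t p w)) => //.
  by have [] := us v va.
have [+ _] := ts v va.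
by move/(_ w); apply: fs_sub => q [].
Qed.

Lemma row_cont m l (f : {linear 'rV[R]_m -> 'rV[R]_l}) U (s : M -> 'rV[R]_m) :
  open U -> smooth_fun U s -> smooth_fun U (fun p => f (s p)).
Proof.
move=> oU hs; apply: (fs_app (l := fun=> f)) => // w; exact: fs_cst.
Qed.

Lemma sub_compat t u : sub_trivs t -> sub_trivs u -> smooth_trans t u.
Proof.
move=> [t' [ta ->]] [u' [ua ->]] w.
have oI : open (tdom t' `&` tdom u') by apply: openI; exact: tdom_open.
have h := smooth_trans2 ta.1 ua.1 (w *m (pid_mx k : 'M_(k, vrank E))).
have := row_cont (mulmxr (pid_mx k : 'M_(vrank E, k))) oI h.
apply: fs_eq => // p [tp up] /=.
by rewrite vsprojK // sub_inv_in.
Qed.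

Definition sub_bundle : vbundle M := VBundle sub_cover sub_compat.

(* s \in Gamma(L), for a section s of E *)
Definition in_sub (s : sect E) := forall p, s p \in L p.

Lemma incl_subproof (s : sect sub_bundle) : smooth_sect (fun p => vsval (s p) : E p).
Proof.
apply: smooth_sect_cover => p; have [t ta tp] := sub_adapted L p.
have oT := @tdom_open _ _ _ _ _ t.
exists t, setT; split=> //; [exact: openT|by case: ta|rewrite setTI].
have tS : @vtrivs _ _ _ sub_bundle (sub_triv ta) by exists t, ta.
have := @sect_smooth _ _ _ sub_bundle s _ tS.
move=> /(row_cont (mulmxr (pid_mx k : 'M_(k, vrank E))) oT).
apply: fs_eq => // q tq /=.
by rewrite pid_pid //; apply/(ta.2 q tq); exact: subvsP.
Qed.
Definition incl (s : sect sub_bundle) : sect E := MkSect (incl_subproof s).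

Lemma incl_in s : in_sub (incl s).
Proof. by move=> p; exact: subvsP. Qed.

Lemma corestr_subproof (s : sect E) (sL : in_sub s) :
  @smooth_sect _ _ _ sub_bundle (fun p => vsproj (L p) (s p)).
Proof.
move=> _ [t [ta ->]] /=.
have oT := @tdom_open _ _ _ _ _ t.
have := smooth_sect_triv (@sect_smooth _ _ _ _ s) ta.1.
move=> /(row_cont (mulmxr (pid_mx k : 'M_(vrank E, k))) oT).
by apply: fs_eq => // q tq /=; rewrite vsprojK.
Qed.
Definition corestr (s : sect E) (sL : in_sub s) : sect sub_bundle :=
  MkSect (corestr_subproof sL).

Lemma incl_corestr (s : sect E) (sL : in_sub s) p : incl (corestr sL) p = s p.
Proof. exact: vsprojK. Qed.

Section Restr.
Variables (B : vbundle M) (a : bmap E B).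
Lemma restr_bmap_subproof t u : @vtrivs _ _ _ sub_bundle t -> @vtrivs _ _ _ B u -> forall w,
  smooth_fun (tdom t `&` tdom u) (fun p => tmap u p (a p (vsval (tinv t p w)))).
Proof.
move=> [t' [ta ->]] ub w; apply: fs_cover => p [tp up].
have [v va vp] := vtrivs_cover E p.
have oI : open (tdom t' `&` tdom v `&` tdom u).
  by do 2?apply: openI => //; exact: tdom_open.
exists (tdom t' `&` tdom v `&` tdom u); split=> //.
pose W := w *m (pid_mx k : 'M_(k, vrank E)).
apply: (@fs_eq _ _ _ _ _ (fun p => (tmap u p \o a p \o tinv v p) (tmap v p (tinv t' p W)))) => //.
  by move=> q [[tq vq] uq] /=; rewrite tmapK // vsprojK // sub_inv_in.
apply: (fs_app (l := fun p => tmap u p \o a p \o tinv v p)) => //.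
  by move=> z; have := @bmap_smooth _ _ _ _ _ a _ _ va ub z; apply: fs_sub => q [[_ ?] ?].
have [+ _] := ta.1 v va.
by move/(_ W); apply: fs_sub => q [].
Qed.
Definition restr_bmap : bmap sub_bundle B :=
  @BMap _ _ _ sub_bundle B (fun p => a p \o vsval) restr_bmap_subproof.
End Restr.
End Sub.
End Subbundle.

Section HomStructures.
Context {R : realType} {n : nat} {M : manifold R n}.
Implicit Types (phi : diffeo M) (A E : vbundle M).

(* A section V of phi^!TM is used through the operator [act V] on C^oo(M); two
   such sections are equal iff their operators are. *)
Definition Ad_pull phi (X : Cinf M -> Cinf M) : Cinf M -> Cinf M :=
  fun f => pull phi (X (pull (diffeo_inv phi) f)).

Definition hom_comm phi (X Y : Cinf M -> Cinf M) (f : Cinf M) : M -> R := fun p =>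
  pull phi (X (pull (diffeo_inv phi) (Y (pull (diffeo_inv phi) f)))) p -
  pull phi (Y (pull (diffeo_inv phi) (X (pull (diffeo_inv phi) f)))) p.

Definition hom_bundle A (h : smap M) (phiA : sect A -> sect A) :=
  linear phiA /\
  forall (f : Cinf M) (X : sect A),
    phiA (sect_smul f X) = sect_smul (pull h f) (phiA X).

Definition invertible_hom_bundle A phi (phiA : sect A -> sect A) :=
  hom_bundle phi phiA /\ bijective phiA.

Record hom_lie_algebroid A phi (phiA : sect A -> sect A)
    (br : sect A -> sect A -> sect A)
    (a : bmap A (pull_bundle phi (tangent_bundle M))) : Prop := {
  hla_bundle : invertible_hom_bundle phi phiA;
  hla_linl : forall Y, linear (br^~ Y);
  hla_linr : forall X, linear (br X);
  hla_skew : forall X Y, br X Y = - br Y X;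
  hla_mult : forall X Y, phiA (br X Y) = br (phiA X) (phiA Y);
  hla_jacobi : forall X Y Z,
    br (phiA X) (br Y Z) + br (phiA Y) (br Z X) + br (phiA Z) (br X Y) = 0;
  hla_leibniz : forall X Y (f : Cinf M),
    br X (sect_smul f Y) =
    sect_smul (pull phi f) (br X Y) +
    sect_smul (act (bapp a (phiA X)) f) (phiA Y);
  hla_anchor_phi : forall X (f : Cinf M) (p : M),
    act (bapp a (phiA X)) (pull phi f) p = pull phi (act (bapp a X) f) p;
  hla_anchor_br : forall X Y (f : Cinf M) (p : M),
    act (bapp a (br X Y)) (pull phi f) p =
    act (bapp a (phiA X)) (act (bapp a Y) f) p -
    act (bapp a (phiA Y)) (act (bapp a X) f) p
}.

(* The property defining the operator D: <<D f, e>> = 1/2 rho(e) f. *)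
Definition is_courant_D E phi (b : bform E)
    (rho : bmap E (pull_bundle phi (tangent_bundle M))) (D : Cinf M -> sect E) :=
  forall (f : Cinf M) (e : sect E) (p : M),
    pairing b (D f) e p = 2^-1 * act (bapp rho e) f p.

Record hom_courant_algebroid E phi (phiE : sect E -> sect E) (b : bform E)
    (op : sect E -> sect E -> sect E)
    (rho : bmap E (pull_bundle phi (tangent_bundle M))) : Prop := {
  hca_bundle : invertible_hom_bundle phi phiE;
  hca_sym : forall p (u v : E p), b p u v = b p v u;
  hca_nondeg : forall p (u : E p), (forall v, b p u v = 0) -> u = 0;
  hca_linl : forall e, linear (op^~ e);
  hca_linr : forall e, linear (op e);
  hca_mult : forall e1 e2, phiE (op e1 e2) = op (phiE e1) (phiE e2);
  hca_leibniz : forall e1 e2 e3,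
    op (phiE e1) (op e2 e3) = op (op e1 e2) (phiE e3) + op (phiE e2) (op e1 e3);
  hca_anchor_phi : forall e (f : Cinf M) (p : M),
    act (bapp rho (phiE e)) f p = Ad_pull phi (act (bapp rho e)) f p;
  hca_anchor_op : forall e1 e2 (f : Cinf M) (p : M),
    act (bapp rho (op e1 e2)) f p =
    hom_comm phi (act (bapp rho e1)) (act (bapp rho e2)) f p;
  hca_sq : exists2 D : Cinf M -> sect E,
    is_courant_D b rho D & forall e, op e e = D (pairing b e e);
  hca_form_phi : forall e1 e2 (p : M),
    pairing b (phiE e1) (phiE e2) p = pull phi (pairing b e1 e2) p;
  hca_form_op : forall e e1 e2 (p : M),
    act (bapp rho (phiE e)) (pairing b e1 e2) p =
    pairing b (op e e1) (phiE e2) p + pairing b (phiE e1) (op e e2) p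
}.

Definition courant_bracket E (op : sect E -> sect E -> sect E) (e1 e2 : sect E) :
  sect E := 2^-1 *: (op e1 e2 - op e2 e1).

Definition isotropic E (b : bform E) (L : subbundle E) :=
  forall p (u v : E p), u \in L p -> v \in L p -> b p u v = 0.

Definition bracket_closed E (br : sect E -> sect E -> sect E) (L : subbundle E) :=
  forall X Y, in_sub L X -> in_sub L Y -> in_sub L (br X Y).

Definition invariant_under E (phiE : sect E -> sect E) (L : subbundle E) :=
  forall X, in_sub L X -> in_sub L (phiE X).

(* Maximality is among isotropic subbundles; it holds in particular when every
   fibre is a maximal isotropic subspace. *)
Record hom_dirac E (phiE : sect E -> sect E) (b : bform E)
    (op : sect E -> sect E -> sect E) (L : subbundle E) : Prop := {
  hd_isotropic : isotropic b L;
  hd_maximal : forall L' : subbundle E, isotropic b L' ->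
    (forall p, (L p <= L' p)%VS) -> forall p, L' p = L p;
  hd_integrable : bracket_closed (courant_bracket op) L;
  hd_invariant : invariant_under phiE L
}.

Definition restr_phi E (phiE : sect E -> sect E) (L : subbundle E)
    (H : invariant_under phiE L) : sect (sub_bundle L) -> sect (sub_bundle L) :=
  fun X => corestr (H (incl X) (incl_in X)).

Definition restr_bracket E (br : sect E -> sect E -> sect E) (L : subbundle E)
    (H : bracket_closed br L) :
    sect (sub_bundle L) -> sect (sub_bundle L) -> sect (sub_bundle L) :=
  fun X Y => corestr (H (incl X) (incl Y) (incl_in X) (incl_in Y)).

End HomStructures.

Arguments hom_lie_algebroid {R n M A} phi phiA br a.
Arguments hom_courant_algebroid {R n M E} phi phiE b op rho.

(* Main.v *)
Require Import Defs.
From mathcomp Require Import all_boot all_order all_algebra.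
From mathcomp Require Import all_classical all_reals.
From mathcomp Require Import topology normedtype derive.
From mathcomp Require Import sequences realfun exp.
From mathcomp Require Import ring lra.
Set Implicit Arguments.
Unset Strict Implicit.
Unset Printing Implicit Defensive.
Import Order.TTheory GRing.Theory Num.Theory.
Import numFieldNormedType.Exports.
Local Open Scope classical_set_scope.
Local Open Scope ring_scope.

(** The bracket of L is the product of E itself.  If X and Y are sections of the
isotropic subbundle L, then <<X + Y, X + Y>> vanishes, so X + Y has square
D 0 = 0; hence the product is skew-symmetric on Gamma(L) and agrees there with
its skew-symmetrization ([op_skew], [courant_bracketE]).  The Jacobi identity of
L is then the Leibniz identity of the product, rearranged by skew-symmetry, and
the two anchor identities are those of E.

The Leibniz rule for a product with f Y ([op_leibniz]) holds in every
Hom-Courant algebroid: expand the compatibility of the anchor with the form at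
<<f Y, e>> using the product rule for vector fields along phi, and cancel phi(e)
by non-degeneracy, phi being onto.

Invertibility of phi_E restricted to L needs phi_E(X) in Gamma(L) to imply X in
Gamma(L) ([phi_reflects_sub]).  Since phi_E preserves the form,
phi_E(X) vanishes at p only if X vanishes at phi(p) ([phi_fiber_inj]).  So
phi_E sends sections of L whose values form a basis of the fibre of L at phi(p)
to sections whose values at p are independent; they lie in the fibre of L at p,
which has the same dimension, hence span it.  If phi_E(X) p is a combination of
them, then X takes the corresponding value, in L, at phi(p).

The form is non-degenerate on fibres, whereas the axioms speak of global
sections.  The bridge is [sect_extend]: every vector of a fibre is the value of
a global smooth section.  It is the smooth cut-off of a local section, and the
cut-off is built from the function exp(-1/x) in a chart; the support of the
cut-off is compact, hence closed because M is Hausdorff. *)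

(** * The flat functions x^-m exp(-1/x) *)

Section FlatFunction.
Context {R : realType}.

Lemma scaleRE (a c : R) : a *: (c : R^o) = a * c.
Proof. by []. Qed.

(** Smoothness of exp(-1/x) is proved for the whole family at once, because the
derivative of a member is a combination of two others. *)
Definition flat (m : nat) (x : R) : R :=
  if 0 < x then x^-1 ^+ m * expR (- x^-1) else 0.

Lemma flat_ge0 m x : 0 <= flat m x.
Proof.
rewrite /flat; case: ifPn => // x0.
by rewrite mulr_ge0 ?expR_ge0 // exprn_ge0 // invr_ge0 ltW.
Qed.

(** A quadratic bound is what makes the derivative at 0 exist and vanish; it
comes from exp(y) >= y^(m+2)/(m+2)! at y = 1/x. *)
Lemma flat_le_sqr m x : flat m x <= (m.+2)`!%:R * x ^+ 2.
Proof.
rewrite /flat; case: ifPn => [x0|_]; last by rewrite mulr_ge0 ?sqr_ge0.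
have y0 : 0 < x^-1 by rewrite invr_gt0.
have e := @expR_ge1Dxn R x^-1 m.+1 (ltW y0).
rewrite expRN ler_pdivrMr ?expR_gt0 //.
have F0 : 0 < (m.+2)`!%:R :> R by rewrite ltr0n fact_gt0.
have -> : x^-1 ^+ m = (m.+2)`!%:R * x ^+ 2 * (x^-1 ^+ m.+2 / (m.+2)`!%:R).
  have xn0 : x != 0 by rewrite gt_eqF.
  have Fn0 : (m.+2)`!%:R != 0 :> R by rewrite gt_eqF.
  rewrite !exprS; move: (x^-1 ^+ m) (_%:R) Fn0 => y F Fn0.
  by field; rewrite Fn0 xn0.
apply: ler_wpM2l; first by rewrite mulr_ge0 ?sqr_ge0.
by apply: le_trans e; rewrite lerDr.
Qed.

Lemma is_derive_flat m (x : R) :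
  is_derive x 1 (flat m) (flat m.+2 x - m%:R * flat m.+1 x).
Proof.
have [x0|x0|->] := ltgtP x 0.
- rewrite /flat !ltNge (ltW x0) /= mulr0 subrr.
  have near0 : \near x, cst 0 x = flat m x.
    near=> y; have y0 : y < 0 by near: y; exact: lt_nbhsl.
    by rewrite /flat ltNge (ltW y0).
  exact: near_eq_is_derive near0 (is_derive_cst _ _ _).
- have xn0 : x != 0 by rewrite gt_eqF.
  have dV : is_derive x 1 (fun y : R => y^-1) (- x ^- 2 *: 1).
    exact: (@is_deriveV R id x 1 1).
  pose f : R -> R := (fun y : R => y^-1) ^+ m * (expR \o (fun y : R => - y^-1)).
  have nearf : \near x, f x = flat m x.
    near=> y; have y0 : 0 < y by near: y; exact: lt_nbhsr.
    by rewrite /flat y0 /f !fctE.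
  have dE : is_derive x 1 (expR \o (fun y : R => - y^-1)) (expR (- x^-1) * x ^- 2).
    apply: is_derive1_comp; apply: is_derive_eq (is_deriveN dV) _.
    by rewrite scaler1 opprK.
  apply: is_derive_eq (near_eq_is_derive nearf (is_deriveM (is_deriveX m dV) dE)) _.
  rewrite /flat x0 !fctE /= !scaleRE mulr1.
  by case: m {f nearf} => [|m] /=; rewrite ?exprS; field.
- rewrite /flat ltxx mulr0 subrr -/(flat m).
  have F0 : 0 < (m.+2)`!%:R :> R by rewrite ltr0n fact_gt0.
  have c0 : (h^-1 *: ((flat m \o shift 0) (h *: 1) - flat m 0)) @[h --> (0 : R)^'] --> (0 : R).
    apply/cvgr0Pnorm_le => e e0; near=> h.
    have h0 : h != 0 by near: h; exact: nbhs_dnbhs_neq.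
    have he : `|h| <= e / (m.+2)`!%:R by near: h; apply: dnbhs0_le; rewrite divr_gt0.
    rewrite /= /shift /= addr0 {2}/flat ltxx subr0 !scaleRE mulr1 normrM normfV.
    rewrite ler_pdivrMl ?normr_gt0 // (ger0_norm (flat_ge0 _ _)).
    apply: le_trans (flat_le_sqr _ _) _.
    rewrite -real_normK ?num_real // expr2 mulrCA; apply: ler_wpM2l => //.
    by rewrite mulrC -ler_pdivlMr.
  by apply: DeriveDef; [apply/cvg_ex; exists 0; exact: c0|exact: cvg_lim].
Unshelve. all: by end_near. Qed.

(** Composing with u inside the induction on k, for all m simultaneously, keeps
the induction hypothesis applicable to both terms of the chain rule. *)
Lemma Ck_flat k (V : normedModType R) (A : set V) (u : V -> R) m : open A ->
  smooth_on A u -> Ck k A (flat m \o u).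
Proof.
move=> oA su.
have dflat m' y : differentiable (flat m') y.
  by apply/derivable1_diffP; have [] := is_derive_flat m' y.
have dc m' x : A x -> differentiable (flat m' \o u) x.
  by move=> Ax; apply: differentiable_comp => //; exact: smooth_diff su Ax.
elim: k m => [|k IH] m.
  by move=> x Ax; apply: differentiable_continuous; exact: dc.
split=> [x|v]; first exact: dc.
apply: (@Ck_eq _ _ _ _ _ (fun x => ('D_v u x : R) *:
    (((flat m.+2 \o u) \+ (fun x => (- m%:R : R) *: ((flat m.+1 \o u) x : R^o))) x : R^o))) => //.
  move=> x Ax; have du := smooth_diff su Ax.
  rewrite (deriveE v (dc m x Ax)) diff_comp //= (diff1E (dflat _ _)) derive1E.
  have -> := @derive_val _ _ _ _ _ _ _ (is_derive_flat m (u x)).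
  by rewrite -deriveE // !scaleRE mulNr.
apply: CkZ => //; first exact: (smooth_derive v su).
apply: CkD => //; apply: (@CkZ _ _ _ _ _ (cst (- m%:R))) => //.
exact: Ck_cst.
Qed.
End FlatFunction.

(** * Bump functions on a manifold *)

Section BumpFunctions.
Context {R : realType} {n : nat}.

(** The Euclidean norm replaces the maximum norm of row vectors because its
square is smooth. *)
Definition radial_gap (x0 : 'rV[R]_n) (r : R) (x : 'rV[R]_n) : R :=
  r ^+ 2 - \sum_i (x 0 i - x0 0 i) ^+ 2.

Lemma smooth_radial_gap x0 r : smooth_on setT (radial_gap x0 r).
Proof.
have oT : open [set: 'rV[R]_n] by exact: openT.
have Cd k i : @Ck R k _ R^o setT ((fun x : 'rV[R]_n => x 0 i : R^o) \+ cst (- x0 0 i)).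
  apply: CkD => //; last exact: Ck_cst.
  apply: Ck_coord => //; elim: k => [|k IH]; first by move=> x _; exact: cvg_id.
  split=> [x _|v]; first exact: ex_diff.
  apply: (@Ck_eq _ _ _ _ _ (cst v)) => [//|x _|]; last exact: Ck_cst.
  by rewrite derive_id.
have Cs k i : @Ck R k _ R^o setT (fun x : 'rV[R]_n =>
    (- (x 0 i - x0 0 i) : R) *: (x 0 i - x0 0 i : R^o)).
  apply: CkZ => //; last exact: Cd.
  apply: (@Ck_eq _ _ 'rV[R]_n R^o _ (fun x => (cst (-1) x : R) *: (x 0 i - x0 0 i : R^o)) (fun x => (- (x 0 i - x0 0 i)))) => //.
    by move=> x _ /=; rewrite scaleN1r.
  by apply: CkZ => //; [exact: Ck_cst|exact: Cd].
move=> k; have := CkD oT (@Ck_cst _ k _ R^o setT (r ^+ 2)) (Ck_sum (index_enum _) xpredT oT (Cs k)).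
apply: (@Ck_eq _ _ _ R^o) => // x _; rewrite /radial_gap /= -sumrN; congr (_ + _); apply: eq_bigr => i _.
by rewrite scaleRE mulNr -expr2.
Qed.

Lemma radial_gap_gt0_dist x0 r x i : 0 < r -> 0 < radial_gap x0 r x -> `|x0 0 i - x 0 i| <= r.
Proof.
move=> r0; rewrite subr_gt0 => h; rewrite distrC -ler_sqr ?nnegrE ?(ltW r0) //.
rewrite real_normK ?num_real //; apply/ltW/le_lt_trans/h.
by rewrite (bigD1 i) //= lerDl sumr_ge0 // => j _; exact: sqr_ge0.
Qed.

Context (M : manifold R n).

(** The closed set K separates p from the complement of U by a neighbourhood of
that complement, which is what makes an extension by zero smooth. *)
Lemma exists_bump (p : M) (U : set M) : open U -> U p ->
  exists (f : Cinf M) (K : set M), [/\ closed K, K `<=` U, f p != 0 &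
    forall q, ~ K q -> f q = 0].
Proof.
move=> oU Up; have [c ca cp] := atlas_cover p.
pose O := [set x | cimg c x /\ U (cinv c x)].
have oO : open O by exact: cinv_open.
have Op : O (c p) by split; [exact: cto_img|rewrite ctoK].
have /nbhs_ballP[e /= e0 eO] : nbhs (c p) O by exact: open_nbhs_nbhs.
(* Half the radius, so that the closed box stays in the open ball. *)
pose r := e / 2; have r0 : 0 < r by rewrite divr_gt0.
pose box := [set x : 'rV[R]_n | forall i, x 0 i \in `[c p 0 i - r, c p 0 i + r]].
have boxO : box `<=` O.
  move=> x bx; apply: eO; split=> // i j; rewrite ord1.
  have := bx j; rewrite in_itv /= => /andP[h1 h2].
  rewrite /ball /= ltr_distl; rewrite /r in h1 h2; apply/andP; split; lra.
pose K := cinv c @` box.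
have cK : closed K.
  apply: compact_closed; first exact: mhausdorff.
  apply: continuous_compact; last first.
    exact: rV_compact (fun i => @segment_compact _ (c p 0 i - r) (c p 0 i + r)).
  apply: continuous_in_subspaceT => x /[!inE] /boxO[cx _]; exact: cinv_cont.
pose u := radial_gap (c p) r.
pose g q : R^o := if q \in cdom c then flat 0 (u (c q)) else 0.
have gK q : ~ K q -> g q = 0.
  move=> Kq; rewrite /g; case: ifPn => // /[!inE] cq.
  rewrite /flat ifN //; apply/negP => uq; apply: Kq; exists (c q); last by rewrite ctoK.
  by move=> i; rewrite in_itv /=; rewrite -ler_distlC; exact: radial_gap_gt0_dist.
have gs : smooth_fun setT g.
  apply: fs_cover => q _; have [cq|cq] := pselect (cdom c q).
    exists (cdom c); split=> //; first exact: cdom_open.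
    apply: (@fs_eq _ _ _ _ _ (flat 0 \o u \o c)); first exact: cdom_open.
      by move=> z cz /=; rewrite /g mem_set.
    have := fs_cto ca openT (fun k => @Ck_flat _ k _ _ _ 0 openT (smooth_radial_gap (c p) r)).
    by apply: fs_sub => z cz.
  exists (~` K); split=> //; first exact: closed_openC.
    by move=> [x /boxO[cx _] xq]; apply: cq; rewrite -xq; exact: cinv_dom.
  apply: (@fs_eq _ _ _ _ _ (cst 0)); first exact: closed_openC.
    by move=> z /gK.
  exact: fs_cst.
exists (MkCinf gs), K; split=> //=.
  by move=> _ [x /boxO[cx Ux] <-].
rewrite /g mem_set // /flat /u /radial_gap big1 ?subr0 ?exprn_gt0 //.
  by rewrite expr0 mul1r gt_eqF ?expR_gt0.
by move=> i _; rewrite subrr expr0n.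
Qed.
End BumpFunctions.

(** * Extension of vectors to global sections *)

Section Extension.
Context {R : realType} {n : nat} {M : manifold R n}.

Lemma sect_extend (A : vbundle M) (p : M) (v : A p) : exists s : sect A, s p = v.
Proof.
have [t ta tp] := vtrivs_cover A p.
have [f [K [cK Kt fp f0]]] := exists_bump (@tdom_open _ _ _ _ _ t) tp.
(* f cuts off the local section of constant coordinates w; dividing by f p makes
   the value at p come out as v. *)
pose w := (f p : R)^-1 *: tmap t p v.
have oK := closed_openC cK.
have ss : smooth_sect (fun q => (f q : R) *: tinv t q w).
  apply: smooth_sect_cover => q; have [tq|tq] := pselect (tdom t q).
    exists t, setT; split=> //; [exact: openT|exact: vtrivs_smooth|rewrite setTI].
    have oT := @tdom_open _ _ _ _ _ t.
    apply: (@fs_eq _ _ _ _ _ (fun q => (f q : R) *: w)) => //.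
      by move=> z tz; rewrite [RHS]linearZ /= (tinvK tz).
    apply: fsZ => //; last exact: fs_cst.
    by apply: fs_sub (@Cinf_smooth _ _ _ f).
  have [u ua uq] := vtrivs_cover A q.
  have oI : open (~` K `&` tdom u) by apply: openI => //; exact: tdom_open.
  exists u, (~` K); split=> //; first by move=> /Kt.
    exact: vtrivs_smooth.
  apply: (@fs_eq _ _ _ _ _ (cst 0)) => //; last exact: fs_cst.
  by move=> z [/f0 fz _]; rewrite fz scale0r linear0.
exists (MkSect ss) => /=.
by rewrite -linearZ scalerA divff // scale1r tmapK.
Qed.
End Extension.

(** * Vector fields along a map as derivations *)

Section Act.
Context {R : realType} {n : nat} {M : manifold R n}.

Lemma CinfP (f g : Cinf M) : f =1 g -> f = g.
Proof.
case: f g => f hf [g hg] /= /funext fg.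
by case: _ / fg hg => hg; congr MkCinf; exact: Prop_irrelevance.
Qed.

Context (h : smap M) (V : sect (pull_bundle h (tangent_bundle M))).

(** The product is given pointwise by k, so that the rule applies to a pairing
<<f Y, e>> as it stands. *)
Lemma act_mul (f g k : Cinf M) p : (forall q, k q = f q * g q) ->
  act V k p = f (h p) * act V g p + g (h p) * act V f p.
Proof.
move=> kE; rewrite /act /= /dfun.
set c := chart_at (h p).
have ca : atlas c by exact: chart_at_atlas.
have cp : cdom c (h p) by exact: chart_at_dom.
have df (f' : Cinf M) : differentiable (f' \o cinv c) (c (h p)).
  by apply: (smooth_diff (Cinf_smooth f' ca)); split=> //; exact: cto_img.
have kcE : k \o cinv c = fun x => (f (cinv c x) : R) *: (g (cinv c x) : R^o).
  by apply/funext => x /=; rewrite kE.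
have [_ D] := is_diff_scale (df f) (df g).
rewrite -!deriveE // kcE D /= ctoK // !scaleRE addrC; congr (_ + _); exact: mulrC.
Qed.

Lemma act_zero (f : Cinf M) p : (forall q, f q = 0) -> act V f p = 0.
Proof.
by move=> f0; rewrite (@act_mul f f f p) ?f0 ?mul0r ?addr0 // => q; rewrite f0 mulr0.
Qed.
End Act.

(** * Linear algebra of sections and fibres *)

Section LinearFacts.
Context (R : realType) (U V : lmodType R) (f : U -> V) (lf : linear f).

Lemma linear_fun_add x y : f (x + y) = f x + f y.
Proof. by rewrite -{1}[x]scale1r lf scale1r. Qed.

Lemma linear_fun0 : f 0 = 0.
Proof. by have /eqP := linear_fun_add 0 0; rewrite addr0 addrC -subr_eq subrr eq_sym => /eqP. Qed.

Lemma linear_fun_scale a x : f (a *: x) = a *: f x.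
Proof. by rewrite -[a *: x]addr0 lf linear_fun0 addr0. Qed.

Lemma linear_fun_opp x : f (- x) = - f x.
Proof. by rewrite -scaleN1r linear_fun_scale scaleN1r. Qed.

Lemma linear_fun_comb (I : Type) (r : seq I) (a : I -> R) (x : I -> U) :
  f (\sum_(i <- r) a i *: x i) = \sum_(i <- r) a i *: f (x i).
Proof.
rewrite (big_morph f linear_fun_add linear_fun0).
by apply: eq_bigr => i _; rewrite linear_fun_scale.
Qed.
End LinearFacts.

Section Sections.
Context {R : realType} {n : nat} {M : manifold R n}.

Lemma dim_fiber r (F : M -> vectType R) (t : triv r F) p :
  tdom t p -> \dim {:F p} = r.
Proof.
move=> tp; pose f := linfun (tmap t p).
have finj : lker f == 0%VS.
  by apply/lker0P => x y; rewrite !lfunE /= => /(can_inj (tmapK tp)).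
have fsurj : limg f = fullv.
  apply/vspaceP => w; rewrite memvf; have := memv_img f (memvf (tinv t p w)).
  by rewrite lfunE /= tinvK.
have := @limg_dim_eq _ _ _ f fullv; rewrite fsurj (eqP finj) capv0 => <- //.
by rewrite dimvf /dim /= mul1n.
Qed.

Lemma dim_sub_fiber (E : vbundle M) (L : subbundle E) p : \dim (L p) = srank L.
Proof.
have [t _ tp] := vtrivs_cover (sub_bundle L) p.
by have := dim_fiber tp; rewrite dimvf.
Qed.

Context (A : vbundle M).
Lemma sectDE (s t : sect A) p : (s + t) p = s p + t p. Proof. by []. Qed.
Lemma sectZE a (s : sect A) p : (a *: s) p = a *: s p. Proof. by []. Qed.
Lemma sectNE (s : sect A) p : (- s) p = - s p.
Proof. by rewrite -scaleN1r sectZE scaleN1r. Qed.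
Lemma sect_sumE I (r : seq I) (P : pred I) (s : I -> sect A) p :
  (\sum_(i <- r | P i) s i) p = \sum_(i <- r | P i) s i p.
Proof. by apply: (big_morph (fun s : sect A => s p)). Qed.

Context (b : bform A).
Lemma bform0l p (w : A p) : b p 0 w = 0.
Proof. exact: (linear0 (bform_linl_lin b w)). Qed.
Lemma bformDl p (u v w : A p) : b p (u + v) w = b p u w + b p v w.
Proof. exact: (linearD (bform_linl_lin b w)). Qed.
Lemma bformZl p a (u w : A p) : b p (a *: u) w = a * b p u w.
Proof. exact: (linearZ_LR (bform_linl_lin b w)). Qed.
Lemma bformNl p (u w : A p) : b p (- u) w = - b p u w.
Proof. exact: (linearN (bform_linl_lin b w)). Qed.
End Sections.

(** * Hom-Courant algebroids *)

Section Courant.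
Context {R : realType} {n : nat} {M : manifold R n}.
Context (E : vbundle M) (phi : diffeo M) (phiE : sect E -> sect E) (b : bform E)
    (op : sect E -> sect E -> sect E)
    (rho : bmap E (pull_bundle phi (tangent_bundle M)))
    (HE : hom_courant_algebroid phi phiE b op rho).

Let phiE_linear : linear phiE. Proof. by have [[]] := hca_bundle HE. Qed.

(** Testing against global sections suffices because they take every value. *)
Lemma sect_nondeg p (u v : E p) :
  (forall e : sect E, b p u (e p) = b p v (e p)) -> u = v.
Proof.
move=> uv; apply/eqP; rewrite -subr_eq0; apply/eqP; apply: (hca_nondeg HE) => w.
have [e <-] := sect_extend w.
by rewrite bformDl bformNl uv subrr.
Qed.

(** phi_E preserves the form, so e(phi(p)) pairs to zero with the value at
phi(p) of every section. *)
Lemma phi_fiber_inj (e : sect E) p : phiE e p = 0 -> e (phi p) = 0.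
Proof.
move=> e0; apply: sect_nondeg => e'.
have := hca_form_phi HE e e' p; rewrite /= e0 => <-.
by rewrite !bform0l.
Qed.

(** The square of e is D of the zero function, and a vector field kills it. *)
Lemma op_self_eq0 (e : sect E) : (forall p, b p (e p) (e p) = 0) -> op e e = 0.
Proof.
move=> e0; have [D DP ->] := hca_sq HE; apply: sectP => p.
apply: sect_nondeg => e'; have := DP (pairing b e e) e' p.
rewrite (@act_zero _ _ _ phi (bapp rho e') (pairing b e e) p e0) mulr0 => {}DP.
rewrite [LHS]DP.
by rewrite bform0l.
Qed.

(** Both sides are paired with phi_E(e), which is arbitrary since phi_E is onto;
the terms in <<phi_E(Y), X e>> cancel. *)
Lemma op_leibniz (X Y : sect E) (f : Cinf M) :
  op X (sect_smul f Y) =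
  sect_smul (pull phi f) (op X Y) +
  sect_smul (act (bapp rho (phiE X)) f) (phiE Y).
Proof.
have [[_ phiS] [psi _ psiK]] := hca_bundle HE.
apply: sectP => p; apply: sect_nondeg => e; rewrite -(psiK e); move: (psi e) => {}e.
have h1 := hca_form_op HE X (sect_smul f Y) e p.
have h2 := hca_form_op HE X Y e p.
have h3 := hca_form_phi HE Y e p.
rewrite (@act_mul _ _ _ phi (bapp rho (phiE X)) f (pairing b Y e)) /= in h1; last by move=> q; rewrite bformZl.
rewrite /= in h2 h3; rewrite h2 phiS /= bformZl -h3 in h1.
rewrite sectDE /= bformDl !bformZl.
by lra.
Qed.

(** * Sections of a Hom-Dirac structure *)

Section Dirac.
Context (L : subbundle E) (HL : hom_dirac phiE b op L).

(** Polarization of X X = 0. *)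
Lemma op_skew (X Y : sect E) : in_sub L X -> in_sub L Y -> op X Y = - op Y X.
Proof.
move=> XL YL.
have self0 (Z : sect E) : in_sub L Z -> op Z Z = 0.
  by move=> ZL; apply: op_self_eq0 => p; exact: (hd_isotropic HL).
have XYL : in_sub L (X + Y) by move=> p; apply: memvD; [exact: XL|exact: YL].
have := self0 _ XYL; rewrite (linear_fun_add (hca_linl HE _)).
rewrite !(linear_fun_add (hca_linr HE _)) (self0 X XL) (self0 Y YL) add0r addr0.
by move=> /eqP; rewrite addr_eq0 => /eqP.
Qed.

Lemma courant_bracketE (X Y : sect E) : in_sub L X -> in_sub L Y ->
  courant_bracket op X Y = op X Y.
Proof.
move=> XL YL; rewrite /courant_bracket (op_skew YL XL) opprK.
have -> : op X Y + op X Y = 2%:R *: op X Y by rewrite scaler_nat mulr2n.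
by rewrite scalerA mulVf ?pnatr_eq0 // scale1r.
Qed.

(** The inverse of phi_E preserves Gamma(L) because the fibres of L all have the
same dimension: the images under phi_E of sections that are a basis of L at
phi(p) are a basis of L at p. *)
Lemma phi_reflects_sub (e : sect E) : in_sub L (phiE e) -> in_sub L e.
Proof.
move=> eL q; rewrite -(diffeo_invK phi q); set p := diffeo_inv phi q.
pose k := \dim (L (phi p)).
have kE x : \dim (L x) = k by rewrite /k !dim_sub_fiber.
pose v (i : 'I_k) : sub_bundle L (phi p) := vsproj (L (phi p)) (vbasis (L (phi p)))`_i.
have [s sv] := fin_all_exists (fun i => sect_extend (v i)).
pose S i := Defs.incl (s i).
have Sb i : S i (phi p) = (vbasis (L (phi p)))`_i.
  by rewrite /S /= sv vsprojK // vbasis_mem // mem_nth // size_tuple kE.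
have phi_comb c : phiE (\sum_i c i *: S i) p = \sum_i c i *: phiE (S i) p.
  by rewrite (linear_fun_comb phiE_linear) sect_sumE.
have comb_at c : (\sum_i c i *: S i) (phi p) = \sum_i c i *: (vbasis (L (phi p)))`_i.
  by rewrite sect_sumE; apply: eq_bigr => i _; rewrite sectZE Sb.
pose T := [tuple phiE (S i) p | i < k].
have Tn (i : 'I_k) : T`_i = phiE (S i) p by rewrite -tnth_nth tnth_mktuple.
have freeT : free T.
  have /freeP vfree := basis_free (vbasisP (L (phi p))).
  apply/freeP => c c0; apply: vfree.
  rewrite -comb_at; apply: phi_fiber_inj; rewrite phi_comb -[RHS]c0.
  by apply: eq_bigr => i _; rewrite Tn.
have spanT : <<T>>%VS = L p.
  apply/eqP; rewrite eqEdim kE (eqP freeT) size_tuple leqnn andbT.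
  by apply/span_subvP => _ /tnthP[i ->]; rewrite tnth_mktuple; exact: (hd_invariant HL) (incl_in _) _.
have := eL p; rewrite -spanT => /coord_span ee.
(* The same combination of the sections S i has the value of e at phi(p). *)
pose c i := coord T i (phiE e p).
have /phi_fiber_inj : phiE (e - \sum_i c i *: S i) p = 0.
  rewrite (linear_fun_add phiE_linear) (linear_fun_opp phiE_linear) sectDE sectNE phi_comb.
  by rewrite {1}ee; apply/eqP; rewrite subr_eq0; apply/eqP; apply: eq_bigr => i _; rewrite Tn.
rewrite sectDE sectNE => /eqP; rewrite subr_eq0 => /eqP ->.
rewrite sect_sumE; apply: rpred_sum => i _; rewrite sectZE rpredZ //.
exact: incl_in.
Qed.
End Dirac.
End Courant.

Theorem proposition4p1 (R : realType) (n : nat) (M : manifold R n)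
    (E : vbundle M) (phi : diffeo M) (phiE : sect E -> sect E) (b : bform E)
    (op : sect E -> sect E -> sect E)
    (rho : bmap E (pull_bundle phi (tangent_bundle M)))
    (HE : hom_courant_algebroid phi phiE b op rho)
    (L : subbundle E) (HL : hom_dirac phiE b op L) :
  hom_lie_algebroid phi (restr_phi (hd_invariant HL))
    (restr_bracket (hd_integrable HL)) (restr_bmap L rho).
Proof.
(* All identities are checked in E: the inclusion of Gamma(L) into Gamma(E) is
   injective and carries every operation of L to that of E. *)
have incl_inj (X Y : sect (sub_bundle L)) : Defs.incl X = Defs.incl Y -> X = Y.
  move=> XY; apply: sectP => p; apply: val_inj.
  exact: (congr1 (fun s : sect E => s p) XY).
have inclD (X Y : sect (sub_bundle L)) : Defs.incl (X + Y) = Defs.incl X + Defs.incl Y.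
  by apply: sectP => p; exact: (linearD (@vsval _ _ (L p))).
have inclZ a (X : sect (sub_bundle L)) : Defs.incl (a *: X) = a *: Defs.incl X.
  by apply: sectP => p; exact: (linearZ_LR (@vsval _ _ (L p))).
have inclN (X : sect (sub_bundle L)) : Defs.incl (- X) = - Defs.incl X.
  by rewrite -scaleN1r inclZ scaleN1r.
have inclS f (X : sect (sub_bundle L)) : Defs.incl (sect_smul f X) = sect_smul f (Defs.incl X).
  by apply: sectP => p; exact: (linearZ_LR (@vsval _ _ (L p))).
have incl0 : Defs.incl (0 : sect (sub_bundle L)) = 0.
  by apply: sectP => p; exact: (linear0 (@vsval _ _ (L p))).
have inL X : in_sub L (@Defs.incl _ _ _ _ L X) by exact: incl_in.
have inclphi X : Defs.incl (restr_phi (hd_invariant HL) X) = phiE (Defs.incl X).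
  by apply: sectP => p; rewrite incl_corestr.
have inclbr X Y : Defs.incl (restr_bracket (hd_integrable HL) X Y) = op (Defs.incl X) (Defs.incl Y).
  by rewrite -(courant_bracketE HE HL (inL X) (inL Y)); apply: sectP => p; rewrite incl_corestr.
have actE X f : act (bapp (restr_bmap L rho) X) f = act (bapp rho (Defs.incl X)) f.
  exact: CinfP.
have pullK f : pull (diffeo_inv phi) (pull phi f) = f.
  by apply: CinfP => p; rewrite /= diffeo_invK.
have [[phil phis] phib] := hca_bundle HE.
have linr := hca_linr HE; have linl := hca_linl HE.
split.
- split; first split.
  + by move=> a X Y; apply: incl_inj; rewrite inclD inclZ !inclphi inclD inclZ phil.
  + by move=> f X; apply: incl_inj; rewrite inclS !inclphi inclS phis.
  + have [psi phiK psiK] := phib.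
    have psiL X : in_sub L (psi (@Defs.incl _ _ _ _ L X)).
      by apply: (phi_reflects_sub HE HL); rewrite psiK; exact: inL.
    exists (fun X => corestr (psiL X)) => X; apply: incl_inj; last first.
      rewrite inclphi -[RHS]psiK; congr (phiE _).
      by apply: sectP => p; rewrite incl_corestr.
    rewrite -[RHS]phiK -inclphi.
    by apply: sectP => p; rewrite incl_corestr.
- move=> Y a X X'; apply: incl_inj.
  by rewrite inclD inclZ !inclbr inclD inclZ linl.
- move=> X a Y Y'; apply: incl_inj.
  by rewrite inclD inclZ !inclbr inclD inclZ linr.
- move=> X Y; apply: incl_inj.
  by rewrite inclN !inclbr (op_skew HE HL).
- by move=> X Y; apply: incl_inj; rewrite !(inclphi, inclbr) (hca_mult HE).
- move=> X Y Z; apply: incl_inj; rewrite incl0 !inclD !(inclphi, inclbr).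
  have phiL (W : sect (sub_bundle L)) : in_sub L (phiE (Defs.incl W)).
    by rewrite -inclphi.
  (* The Leibniz identity splits the first term into the opposites of the other
     two, up to skew-symmetry inside one and outside the other. *)
  rewrite (hca_leibniz HE) (op_skew HE HL (inL Z) (inL X)).
  rewrite (linear_fun_opp (linr _)).
  rewrite (op_skew HE HL (phiL Z)); last by rewrite -inclbr.
  by rewrite addrK subrr.
- move=> X Y f; apply: incl_inj.
  by rewrite inclD !inclS !inclbr !inclS inclphi actE inclphi (op_leibniz HE).
- by move=> X f p; rewrite !actE inclphi (hca_anchor_phi HE) /Ad_pull pullK.
- move=> X Y f p; rewrite !actE inclbr !inclphi (hca_anchor_op HE) /hom_comm !pullK.
  by rewrite !(hca_anchor_phi HE).
Qed.
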